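(* Let $a\ge b\ge 12$ be integers with $3\mid b$. If the spider $S(a,b,2)$ is $e$-positive, then \[a\ge\begin{cases}3b+3,&\text{if } a\equiv 0\pmod 3,\\[3pt] \dfrac{b}{2}+\dfrac94+\dfrac{\sqrt{12b^2-180b+565}}{4},&\text{if } a\equiv1\pmod 3,\\[6pt] \dfrac b2+\dfrac13+\dfrac{\sqrt{27b^2-54b+112}}{6},&\text{if } a\equiv 2\pmod 3.\end{cases}\] *)

(* Defs.v *)
From mathcomp Require Import all_boot all_algebra.
From mathcomp Require Import mpoly.

Set Implicit Arguments.
Unset Strict Implicit.
Unset Printing Implicit Defensive.

Import GRing.Theory Num.Theory.

(* The spider S(a,b,c): a center vertex 0 with three legs (paths) of       *)
(* a, b, c vertices attached to it.  Vertices are 0 .. a+b+c :             *)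
(*   center 0; leg 1 = 1..a ; leg 2 = a+1..a+b ; leg 3 = a+b+1..a+b+c,     *)
(* each leg being a path whose first vertex is adjacent to the center.    *)
Definition spider_order (a b c : nat) : nat := (a + b + c).+1.

Definition spider_adj0 (a b c : nat) (i j : nat) : bool :=
  ((i == 0%nat) && [|| (j == 1%nat) && (0 < a)%nat,
                     (j == a.+1) && (0 < b)%nat
                   | (j == (a + b).+1) && (0 < c)%nat])
  || [&& (0 < i)%nat, j == i.+1, i != a, i != (a + b)%nat & (j <= a + b + c)%nat].

Definition spider_adj (a b c : nat) : rel 'I_(spider_order a b c) :=
  fun i j => spider_adj0 a b c i j || spider_adj0 a b c j i.

(* For a graph on 'I_n (adjacency relation adj), its chromatic symmetric   *)
(* function X_G, which is homogeneous of degree n, realised in n variables *)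
(* x_0..x_{n-1}: sum over proper colourings k of prod_v x_{k v}.           *)
Definition proper_coloring (n : nat) (adj : rel 'I_n) (k : {ffun 'I_n -> 'I_n}) :=
  [forall i, forall j, adj i j ==> (k i != k j)].

Definition chromsym (n : nat) (adj : rel 'I_n) : {mpoly rat[n]} :=
  (\sum_(k : {ffun 'I_n -> 'I_n} | proper_coloring adj k) \prod_(v : 'I_n) 'X_(k v))%R.

Definition is_partition (m : nat) (la : seq nat) : bool :=
  [&& sorted geq la, all (fun p => 0 < p)%nat la & sumn la == m].

Definition elem_sym (n : nat) (la : seq nat) : {mpoly rat[n]} :=
  (\prod_(p <- la) mesym n rat p)%R.

Definition e_positive (n : nat) (X : {mpoly rat[n]}) : Prop :=
  exists s : seq (rat * seq nat),
    all (fun cl => (0 <= cl.1)%R && is_partition n cl.2) s /\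
    X = (\sum_(cl <- s) cl.1 *: elem_sym n cl.2)%R.

Definition spider_e_positive (a b c : nat) : Prop :=
  e_positive (chromsym (@spider_adj a b c)).

(* Main.v *)
Require Import Defs.
From mathcomp Require Import all_boot all_order all_algebra.
From mathcomp Require Import mpoly.
From mathcomp Require Import ring lra zify.

(* Cutting the legs of the spider at its centre expresses X_{S(a,b,2)} through the
   chromatic symmetric functions P_m of paths:
     P_n + P_1 P_{n-1} + P_2 P_{n-2} - P_{b+1} P_{a+2} - P_{b+2} P_{a+1},  n = a + b + 3,
   where P_m = e_m + sum_{k >= 2} (k - 1) e_k P_{m-k}. Since the e_k are algebraically
   independent, all e_k but e_3 and one e_q may be set to zero, and every coefficient of
   e_q^j e_3^k must be nonnegative. Modulo 3 only few terms of the two products contribute,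
   and the coefficients are explicit polynomials in a and b: e_5^2 e_3^k gives the bound for
   a = 1 mod 3, e_4^2 e_3^k the one for a = 2 mod 3; for a = 0 mod 3, e_4^3 e_3^k excludes
   a <= 2b + 3 and e_4^6 e_3^k excludes 2b + 6 <= a <= 3b. *)

Set Implicit Arguments.
Unset Strict Implicit.
Unset Printing Implicit Defensive.

Import Order.TTheory GRing.Theory Num.Theory.

Local Open Scope ring_scope.

(** * Colourings of paths and legs *)

Section PathColourings.
Variables (R : comNzRingType) (C : finType) (x : C -> R).

(** The weighted sum over proper colourings of [m] path vertices hanging from a vertex coloured [c],
    the weight of that vertex excluded. *)
Fixpoint leg (m : nat) (c : C) : R :=
  if m is m'.+1 then \sum_(d | d != c) x d * leg m' d else 1.

Definition pathsum (m : nat) : R :=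
  if m is m'.+1 then \sum_c x c * leg m' c else 1.

Lemma legS m c : leg m.+1 c = pathsum m.+1 - x c * leg m c.
Proof. by rewrite /= [in RHS](bigD1 c) //= addrC addrK. Qed.

Arguments leg : simpl never.
Arguments pathsum : simpl never.

Lemma pathsumS m : pathsum m.+1 = \sum_c x c * leg m c.
Proof. by []. Qed.

(** By [legS], moving a vertex from one leg to the other changes the sum only by products with a
    detached path. The weight [y] is 1 for a path and a third leg for a spider. *)
Lemma sum_legs_shift (y : C -> R) a b :
  \sum_c x c * leg a c * (y c * leg b.+1 c) =
  pathsum b.+1 * (\sum_c x c * leg a c * y c)
  - pathsum a.+1 * (\sum_c x c * leg b c * y c)
  + \sum_c x c * leg a.+1 c * (y c * leg b c).
Proof.
rewrite !mulr_sumr -sumrB -big_split; apply: eq_bigr => c _ /=.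
rewrite !legS; ring.
Qed.

(** Vertices move one at a time until the second leg is empty; for [y] = 1 the two correction
    products cancel. *)
Lemma sum_two_legs a b :
  \sum_c x c * leg a c * leg b c = pathsum (a + b).+1.
Proof.
elim: b a => [|b IHb] a; first by rewrite addn0; apply: eq_bigr => c _; rewrite mulr1.
have := sum_legs_shift (fun=> 1) a b.
under eq_bigr do rewrite mul1r.
move=> ->; under eq_bigr do rewrite mulr1.
rewrite -/(pathsum a.+1) [X in _ - _ * X](_ : _ = pathsum b.+1); last first.
  by apply: eq_bigr => c _; rewrite mulr1.
rewrite [X in X - _]mulrC subrr add0r.
under eq_bigr do rewrite mul1r.
by rewrite IHb addSnnS.
Qed.

(** The short leg gives its two vertices to the leg of length [b] one by one; each move leaves two
    products, and a path remains. *)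
Lemma sum_spider2 a b :
  \sum_c x c * (leg a c * leg b c * leg 2 c) =
  pathsum (a + b).+3 + pathsum 1 * pathsum (a + b).+2
  + pathsum 2 * pathsum (a + b).+1
  - pathsum b.+1 * pathsum a.+2 - pathsum b.+2 * pathsum a.+1.
Proof.
have shift b' c' : \sum_c x c * (leg a c * leg b' c * leg c'.+1 c) =
    pathsum c'.+1 * pathsum (a + b').+1 - pathsum b'.+1 * pathsum (a + c').+1
    + \sum_c x c * (leg a c * leg b'.+1 c * leg c' c).
  have := sum_legs_shift (leg a) b' c'.
  rewrite (eq_bigr (fun c => x c * (leg a c * leg b' c * leg c'.+1 c))); last first.
    by move=> c _; rewrite -!mulrA; congr (_ * _); rewrite mulrCA.
  move=> ->; congr (_ * _ - _ * _ + _).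
  - by rewrite addnC sum_two_legs.
  - by rewrite addnC sum_two_legs.
  - by apply: eq_bigr => c _; rewrite -!mulrA; congr (_ * _); rewrite mulrCA.
rewrite !shift addn0 addn1 addnS.
under eq_bigr do rewrite mulr1 mulrA.
rewrite sum_two_legs !addnS; ring.
Qed.

(** * Generating function of the path sums *)

Lemma deriv_prod (S : comNzRingType) (I : eqType) (r : seq I) (F : I -> {poly S}) :
  uniq r ->
  (\prod_(i <- r) F i)^`() = \sum_(i <- r) (F i)^`() * \prod_(j <- r | j != i) F j.
Proof.
elim: r => [|i r IHr] /=; first by rewrite !big_nil derivC.
case/andP=> ir ur; rewrite !big_cons derivM (IHr ur) eqxx /=; congr (_ * _ + _).
  rewrite [LHS]big_seq [RHS]big_seq_cond; apply: eq_bigl => j.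
  by case: eqP => [->|]; rewrite ?andbT // (negPf ir).
rewrite mulr_sumr [LHS]big_seq [RHS]big_seq; apply: eq_bigr => j jr.
rewrite big_cons; case: eqP => [eq_ij|_]; last by rewrite mulrCA.
by rewrite eq_ij jr in ir.
Qed.

Definition epoly : {poly R} := \prod_c (1 + (x c)%:P * 'X).

Lemma deriv_epoly :
  epoly^`() = \sum_c (x c)%:P * \prod_(d | d != c) (1 + (x d)%:P * 'X).
Proof.
rewrite /epoly deriv_prod ?index_enum_uniq //.
apply: eq_bigr => c _.
by rewrite derivD derivM derivX !derivC mul0r !add0r mulr1.
Qed.

(* With P(z) and L_c(z) the generating functions of [pathsum] and [leg _ c],
   (1 + x_c z) L_c = P and P = 1 + z * sum_c x_c L_c, so E P = E + z E' P. The
   series are truncated at degree M, hence the multiples of z^(M+1). *)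
Lemma epoly_pathsum M :
  \sum_(i < M.+1) epoly`_i * pathsum (M - i) =
  epoly`_M + \sum_(i < M) epoly`_i.+1 *+ i.+1 * pathsum (M.-1 - i).
Proof.
pose P : {poly R} := \poly_(j < M.+1) pathsum j.
pose L c : {poly R} := \poly_(j < M.+1) leg j c.
have LE c : (1 + (x c)%:P * 'X) * L c = P + (x c * leg M c)%:P * 'X^(M.+1).
  apply/polyP=> i; rewrite mulrDl mul1r -mulrA !coefD !coefCM coefXM coefXn.
  rewrite !coef_poly; case: i => [|i] /=; first by rewrite mulr0 mulr0.
  rewrite !ltnS eqSS; case: (ltngtP i M) => [lt_iM|gt_iM|->].
  - by rewrite legS mulr0 addr0 subrK.
  - by rewrite !mulr0 !addr0.
  - by rewrite mulr1 add0r.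
have PE : P + (pathsum M.+1)%:P * 'X^(M.+1) = 1 + 'X * \sum_c (x c)%:P * L c.
  apply/polyP=> i; rewrite !coefD coefCM coefXn coefXM coef1 coef_poly.
  case: i => [|i] /=; first by rewrite mulr0.
  rewrite coef_sum add0r ltnS eqSS.
  under eq_bigr do rewrite coefCM coef_poly ltnS.
  case: (ltngtP i M) => [lt_iM|gt_iM|->].
  - by rewrite mulr0 addr0 pathsumS.
  - by rewrite mulr0 addr0 big1 // => c _; rewrite mulr0.
  - by rewrite mulr1 add0r pathsumS.
have EP : epoly * P = epoly + 'X * (epoly^`() * P)
    + 'X^(M.+1) * ('X * \sum_c (x c)%:P * (x c * leg M c)%:P
          * \prod_(d | d != c) (1 + (x d)%:P * 'X)
        - (pathsum M.+1)%:P * epoly).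
  have -> : epoly * P = epoly * (1 + 'X * \sum_c (x c)%:P * L c)
                        - (pathsum M.+1)%:P * 'X^(M.+1) * epoly.
    by rewrite -PE; ring.
  rewrite deriv_epoly mulrDr mulr1.
  have -> : epoly * ('X * \sum_c (x c)%:P * L c) =
      'X * \sum_c (x c)%:P * (\prod_(d | d != c) (1 + (x d)%:P * 'X)
        * (P + (x c * leg M c)%:P * 'X^(M.+1))).
    rewrite mulrCA; congr (_ * _); rewrite mulr_sumr; apply: eq_bigr => c _.
    by rewrite -LE /epoly (bigD1 c) //=; ring.
  under eq_bigr do rewrite mulrDr mulrDr !mulrA.
  rewrite big_split /= -!mulr_suml.
  set s1 := \sum_c _; set s2 := \sum_c _; set s3 := \sum_c _.
  have -> : s2 = s3 by apply: eq_bigr => c _; ring.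
  by ring.
move/(congr1 (fun p : {poly R} => p`_M)): EP.
rewrite !coefD coefXM coefXnM ltnS leqnn addr0 coefM.
under eq_bigr => i _ do rewrite coef_poly ltnS leq_subr.
move=> ->; congr (_ + _); case: posnP => [->|M_gt0]; first by rewrite big_ord0.
rewrite coefM prednK //; apply: eq_bigr => i _.
by rewrite coef_deriv coef_poly ltnS (leq_trans (leq_subr _ _)) ?leq_pred.
Qed.

(** In [epoly_pathsum] the term i = 0 is the new path sum, since e_0 = 1; carrying the other terms
    across lowers each factor i + 1 to i. *)
Lemma pathsum_rec M :
  pathsum M.+1 = epoly`_M.+1 + \sum_(i < M.+1) epoly`_i.+1 *+ i * pathsum (M - i).
Proof.
have e0 : epoly`_0 = 1.
  rewrite -horner_coef0 horner_prod big1 // => c _.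
  by rewrite hornerD hornerM hornerX mulr0 addr0 hornerC.
have := epoly_pathsum M.+1; rewrite big_ord_recl e0 mul1r subn0 /=.
move/(canRL (addrK _)) => ->; rewrite -addrA -sumrB; congr (_ + _).
by apply: eq_bigr => i _; rewrite /bump add1n subSS mulrS mulrDl addrC addrA addNr add0r.
Qed.

End PathColourings.

(** * Specialising the elementary symmetric functions *)

Lemma coef_epoly_mesym (R : comNzRingType) n k :
  (epoly (fun i : 'I_n => 'X_i : {mpoly R[n]}))`_k = mesym n R k.
Proof.
rewrite /epoly; under eq_bigr do rewrite addrC.
rewrite bigA_distr coef_sum /mesym [RHS]big_mkcond /=.
apply: eq_bigr => J _; rewrite -big_mkcond /= big_split /= -rmorph_prod /=.
rewrite prodr_const coefCM coefXn eq_sym.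
by case: eqP => _; rewrite ?mulr1 ?mulr0.
Qed.

Section PathSeq.
Variable (R : nzRingType).
Implicit Types e : nat -> R.

(* [pathseq_rev e m] lists P_m, ..., P_0 for the recurrence with data [e]; [e 0] is ignored. *)
Fixpoint pathseq_rev e m : seq R :=
  if m is m'.+1 then
    (e m + \sum_(i < m) e i.+1 *+ i * (pathseq_rev e m')`_i) :: pathseq_rev e m'
  else [:: 1].

Definition pathseq e m : R := (pathseq_rev e m)`_0.

Lemma nth_pathseq_rev e m i : (i <= m)%N -> (pathseq_rev e m)`_i = pathseq e (m - i).
Proof.
elim: m i => [|m IHm] [|i] //=; rewrite ltnS => le_im.
by rewrite IHm.
Qed.

Lemma pathseqS e m :
  pathseq e m.+1 = e m.+1 + \sum_(i < m.+1) e i.+1 *+ i * pathseq e (m - i).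
Proof.
rewrite {1}/pathseq /=; congr (_ + _); apply: eq_bigr => i _.
by rewrite nth_pathseq_rev // -ltnS.
Qed.

Lemma pathseq_unique e (p : nat -> R) : p 0%N = 1 ->
  (forall m, p m.+1 = e m.+1 + \sum_(i < m.+1) e i.+1 *+ i * p (m - i)%N) ->
  p =1 pathseq e.
Proof.
move=> p0 pS m; have [k] := ubnP m; elim: k m => // k IHk [|m] lt_mk //.
rewrite pS pathseqS; congr (_ + _); apply: eq_bigr => i _.
by rewrite IHk // (leq_ltn_trans (leq_subr _ _)).
Qed.

(** The form of [sum_spider2] for an arbitrary sequence, so that ring morphisms can be applied to
    it. *)
Definition spider2_expr (p : nat -> R) a b : R :=
  p (a + b).+3 + p 1%N * p (a + b).+2 + p 2%N * p (a + b).+1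
  - p b.+1 * p a.+2 - p b.+2 * p a.+1.

End PathSeq.

Lemma rmorph_pathseq (R S : nzRingType) (f : {rmorphism R -> S}) (e : nat -> R) m :
  f (pathseq e m) = pathseq (f \o e) m.
Proof.
move: m; apply: pathseq_unique => [|m]; first by rewrite rmorph1.
rewrite pathseqS rmorphD rmorph_sum; congr (_ + _); apply: eq_bigr => i _.
by rewrite rmorphM rmorphMn.
Qed.

Lemma pathsum_mesym (R : comNzRingType) n m :
  pathsum (fun i : 'I_n => 'X_i : {mpoly R[n]}) m = pathseq (mesym n R) m.
Proof.
move: m; apply: pathseq_unique => // m.
rewrite pathsum_rec coef_epoly_mesym; congr (_ + _).
by apply: eq_bigr => i _; rewrite coef_epoly_mesym.
Qed.

Lemma eq_pathseq (R : nzRingType) (e e' : nat -> R) :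
  (forall k, e k.+1 = e' k.+1) -> pathseq e =1 pathseq e'.
Proof.
move=> ee'; apply: pathseq_unique => // m; rewrite pathseqS ee'.
by congr (_ + _); apply: eq_bigr => i _; rewrite ee'.
Qed.

Lemma rmorph_spider2_expr (R S : nzRingType) (f : {rmorphism R -> S}) p a b :
  f (spider2_expr p a b) = spider2_expr (f \o p) a b.
Proof. by rewrite /spider2_expr !(rmorphB, rmorphD, rmorphM). Qed.

Lemma eq_spider2_expr (R : nzRingType) (p q : nat -> R) a b :
  p =1 q -> spider2_expr p a b = spider2_expr q a b.
Proof. by move=> pq; rewrite /spider2_expr !pq. Qed.

(* Elementary symmetric functions are algebraically independent, so the
   formal variables e_1, ..., e_n may be given arbitrary nonnegative values. *)
Lemma e_positive_specialize n a b (e : nat -> {poly rat}) :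
  (forall k i, 0 <= (e k)`_i) -> (forall k, (n < k)%N -> e k = 0) ->
  e_positive (spider2_expr (pathseq (mesym n rat)) a b) ->
  forall i, 0 <= (spider2_expr (pathseq e) a b)`_i.
Proof.
move=> e_ge0 e_gt [s [/allP s_ok sE]] deg.
(* [t k] is the formal variable for e_k, with the values 1 at k = 0 and 0 beyond [n] that e_k takes
   in [n] variables. *)
pose t k : {mpoly rat[n]} :=
  if k is k'.+1 then if insub k' is Some i then 'X_i else 0 else 1.
pose S := [tuple mesym n rat i.+1 | i < n].
have tS k : t k \mPo S = mesym n rat k.
  case: k => [|k] /=; first by rewrite comp_mpoly1 mesym0E.
  case: insubP => [i lt_kn <-|]; first by rewrite comp_mpolyXU -tnth_nth tnth_mktuple.
  by rewrite -leqNgt => le_nk; rewrite comp_mpoly0 mesym_geqnE.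
pose f : {rmorphism {mpoly rat[n]} -> {poly rat}} := mmap (@polyC rat) (fun i : 'I_n => e i.+1).
have ft k : (0 < k)%N -> f (t k) = e k.
  case: k => [//|k] _ /=; case: insubP => [i lt_kn <-|].
    by rewrite /f mmapX mmap1U.
  by rewrite -leqNgt => le_nk; rewrite /f mmap0 e_gt.
pose mon (la : seq nat) := \prod_(p <- la) t p.
have tE : spider2_expr (pathseq t) a b = \sum_(cl <- s) cl.1 *: mon cl.2.
  (* Algebraic independence: substituting the e_k for the variables is injective, so the identity
     may be checked after substitution. *)
  apply: msym_fundamental_un; rewrite -/S rmorph_spider2_expr.
  rewrite (@eq_spider2_expr _ _ (pathseq (mesym n rat))); last first.
    move=> m /=; rewrite rmorph_pathseq.
    by apply: eq_pathseq => k; rewrite -tS.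
  rewrite sE raddf_sum /=; apply: eq_bigr => cl _.
  rewrite comp_mpolyZ /elem_sym /mon rmorph_prod /=.
  by congr (_ *: _); apply: eq_bigr => p _; rewrite tS.
have -> : spider2_expr (pathseq e) a b = f (spider2_expr (pathseq t) a b).
  rewrite rmorph_spider2_expr; apply: eq_spider2_expr => m /=.
  by rewrite rmorph_pathseq; apply: eq_pathseq => k; rewrite /= -ft.
rewrite tE raddf_sum coef_sum big_seq sumr_ge0 // => cl /s_ok.
case/andP=> cl_ge0 /and3P[_ /allP la_gt0 _].
rewrite /= mmapZ coefCM mulr_ge0 // -/f /mon rmorph_prod /= big_seq.
elim/big_rec: _ deg => [|p q /la_gt0 p_gt0 q_ge0] deg.
  by rewrite coef1; case: eqP.
rewrite coefM sumr_ge0 // => j _; rewrite mulr_ge0 //.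
by have /= -> := ft _ p_gt0.
Qed.

(** * Colourings of the spider *)

Section WordSums.
Variables (R : comNzRingType) (C : finType) (x : C -> R).
Implicit Types F G : seq C -> R.

(** Words encode colourings because the spider's vertices are listed as the centre followed by the
    three legs, so the sum splits along concatenation. *)
Fixpoint wordsum m F : R :=
  if m is m'.+1 then \sum_c wordsum m' (fun s => F (c :: s)) else F [::].

Lemma eq_wordsum m F G :
  (forall s, size s = m -> F s = G s) -> wordsum m F = wordsum m G.
Proof.
elim: m F G => [|m IHm] F G FG /=; first exact: FG.
by apply: eq_bigr => c _; apply: IHm => s sz_s; apply: FG; rewrite /= sz_s.
Qed.

Lemma wordsum_cat m n F :
  wordsum (m + n) F = wordsum m (fun s => wordsum n (fun t => F (s ++ t))).
Proof. by elim: m F => //= m IHm F; apply: eq_bigr => c _; rewrite IHm. Qed.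

Lemma wordsumZ m (z : R) F : wordsum m (fun s => z * F s) = z * wordsum m F.
Proof.
by elim: m F => //= m IHm F; rewrite mulr_sumr; apply: eq_bigr => c _; rewrite -IHm.
Qed.

Lemma sum_ffun_wordsum m F :
  \sum_(k : {ffun 'I_m -> C}) F [seq k i | i <- enum 'I_m] = wordsum m F.
Proof.
elim: m F => [|m IHm] F /=.
  have -> : enum 'I_0 = [::] by apply: size0nil; rewrite size_enum_ord.
  by rewrite /= big_const card_ffun card_ord expn0 /= addr0.
pose cons_ffun (ck : C * {ffun 'I_m -> C}) : {ffun 'I_m.+1 -> C} :=
  [ffun i => if unlift ord0 i is Some j then ck.2 j else ck.1].
rewrite (reindex cons_ffun) /=; last first.
  exists (fun k => (k ord0, [ffun j => k (lift ord0 j)])) => [[c k]|k] _.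
    rewrite /cons_ffun /=; congr (_, _); first by rewrite ffunE unlift_none.
    by apply/ffunP=> j; rewrite !ffunE liftK.
  by apply/ffunP=> i; rewrite !ffunE; case: unliftP => [j ->|->]; rewrite ?ffunE.
rewrite -(pair_bigA _ (fun c k => F [seq cons_ffun (c, k) i | i <- enum 'I_m.+1])) /=.
apply: eq_bigr => c _; rewrite -IHm; apply: eq_bigr => k _; congr F.
rewrite enum_ordSl /= ffunE unlift_none -map_comp; congr (_ :: _).
by apply: eq_map => j; rewrite /= ffunE liftK.
Qed.

Definition rdiff : rel C := fun c d => d != c.

Lemma wordsum_path m c :
  wordsum m (fun s => (path rdiff c s)%:R * \prod_(d <- s) x d) = leg x m c.
Proof.
elim: m c => [|m IHm] c /=; first by rewrite big_nil mulr1.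
rewrite [RHS]big_mkcond; apply: eq_bigr => d _ /=.
rewrite -IHm; case: ifP => dc; last first.
  rewrite -[RHS](mul0r (wordsum m (fun=> 1))) -wordsumZ.
  by apply: eq_wordsum => s _; rewrite /rdiff dc !mul0r.
rewrite -wordsumZ; apply: eq_wordsum => s _.
by rewrite {1}/rdiff dc big_cons mulrCA.
Qed.

(** A leg is the block of vertices starting at o + 1. Its first vertex is compared with the centre
    rather than with vertex o, hence the separate clause. *)
Lemma path_rdiffP (w : nat -> C) c t o :
  (forall i, (i < size t)%N -> nth c t i = w (o.+1 + i)%N) ->
  reflect (((0 < size t)%N -> w o.+1 != c) /\
           (forall i, (o < i < o + size t)%N -> w i.+1 != w i))
          (path rdiff c t).
Proof.
move=> tw; apply: (iffP (pathP c)) => [pt|[t0 tS] [|i] lt_it] /=.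
- split=> [t_gt0|i /andP[lt_oi lt_it]].
    by have := pt _ t_gt0; rewrite /rdiff /= tw // addn0.
  have /pt : (i - o < size t)%N by lia.
  rewrite /rdiff tw; last by lia.
  have -> : (i - o = (i - o.+1).+1)%N by lia.
  rewrite /= tw; last by lia.
  by congr (w _ != w _); lia.
- by rewrite /rdiff tw // addn0 t0.
- rewrite /rdiff !tw ?(ltnW lt_it) // addnS; apply: tS; lia.
Qed.

(** Once the centre has colour [c] the three blocks are independent, so the sum factors. *)
Lemma wordsum_spider a b l :
  wordsum (spider_order a b l) (fun s =>
    (if s is c :: t then
       [&& path rdiff c (take a t), path rdiff c (take b (drop a t))
         & path rdiff c (drop (a + b) t)] else false)%:R * \prod_(d <- s) x d) =
  \sum_c x c * (leg x a c * leg x b c * leg x l c).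
Proof.
rewrite /spider_order /=; apply: eq_bigr => c _.
pose G s := (path rdiff c s)%:R * \prod_(d <- s) x d.
rewrite !wordsum_cat.
transitivity (wordsum a (fun s => x c * leg x b c * leg x l c * G s)); last first.
  by rewrite wordsumZ wordsum_path; ring.
apply: eq_wordsum => s1 sz1.
transitivity (wordsum b (fun s => x c * G s1 * leg x l c * G s)); last first.
  by rewrite wordsumZ wordsum_path; ring.
apply: eq_wordsum => s2 sz2.
transitivity (wordsum l (fun s => x c * G s1 * G s2 * G s)); last first.
  by rewrite wordsumZ wordsum_path; ring.
apply: eq_wordsum => s3 sz3.
rewrite -catA take_size_cat // drop_size_cat // take_size_cat //.
rewrite catA drop_size_cat ?size_cat ?sz1 ?sz2 // big_cons !big_cat /= /G.
by rewrite -!mulnb !natrM; ring.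
Qed.

End WordSums.

Lemma proper_spiderP a b l
    (k : {ffun 'I_(spider_order a b l) -> 'I_(spider_order a b l)}) c t :
  [seq k i | i <- enum 'I_(spider_order a b l)] = c :: t ->
  proper_coloring (@spider_adj a b l) k =
  [&& path (@rdiff _) c (take a t), path (@rdiff _) c (take b (drop a t))
    & path (@rdiff _) c (drop (a + b) t)].
Proof.
move=> kE; have sz_t : size t = (a + b + l)%N.
  by have /(congr1 size) := kE; rewrite size_map size_enum_ord => -[].
pose w i := nth c (c :: t) i.
have wk (i : 'I_(spider_order a b l)) : w i = k i.
  by rewrite /w -kE (nth_map i) ?size_enum_ord // nth_ord_enum.
have sz1 : size (take a t) = a by rewrite size_takel // sz_t; lia.
have sz2 : size (take b (drop a t)) = b by rewrite size_takel // size_drop sz_t; lia.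
have sz3 : size (drop (a + b) t) = l by rewrite size_drop sz_t; lia.
have w0 : w 0%N = c by [].
have P1 := @path_rdiffP _ w c (take a t) 0; rewrite sz1 in P1.
have P2 := @path_rdiffP _ w c (take b (drop a t)) a; rewrite sz2 in P2.
have P3 := @path_rdiffP _ w c (drop (a + b) t) (a + b); rewrite sz3 in P3.
have {}P1 := P1 (fun i lt_i => nth_take _ lt_i _).
have {}P2 := P2 (fun i lt_i => etrans (nth_take _ lt_i _) (nth_drop _ _ _ _)).
have {}P3 := P3 (fun i lt_i => nth_drop _ _ _ _).
(* Distinctness is symmetric, so only the oriented edges of [spider_adj0] need checking. *)
have adjP : reflect (forall i j, (i <= a + b + l)%N -> (j <= a + b + l)%N ->
    spider_adj0 a b l i j -> w j != w i) (proper_coloring (@spider_adj a b l) k).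
  apply: (iffP forallP) => [kP i j lt_i lt_j ij|wP i].
    have /forallP/(_ (Ordinal (lt_j : j < spider_order a b l)%N)) :=
      kP (Ordinal (lt_i : i < spider_order a b l)%N).
    by rewrite /spider_adj /= ij -!wk eq_sym.
  apply/forallP => j; apply/implyP; rewrite /spider_adj -!wk.
  case/orP => /wP H; last by apply: H; rewrite -ltnS.
  by rewrite eq_sym; apply: H; rewrite -ltnS.
apply/adjP/and3P => [wP|[/P1[h1 s1] /P2[h2 s2] /P3[h3 s3]] i j le_i le_j].
  split.
  - apply/P1; split=> [a0|i lt_i].
      by rewrite -w0; apply: wP; rewrite /spider_adj0; lia.
    by apply: wP; rewrite /spider_adj0; lia.
  - apply/P2; split=> [b0|i lt_i].
      by rewrite -w0; apply: wP; rewrite /spider_adj0; lia.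
    by apply: wP; rewrite /spider_adj0; lia.
  - apply/P3; split=> [l0|i lt_i].
      by rewrite -w0; apply: wP; rewrite /spider_adj0; lia.
    by apply: wP; rewrite /spider_adj0; lia.
case/orP => [/andP[/eqP-> /or3P[]] /andP[/eqP-> pos]|].
- by rewrite w0 h1.
- by rewrite w0 h2.
- by rewrite w0 h3.
case/and5P => i0 /eqP ji ia iab _; rewrite ji in le_j *.
have [lt_ia|le_ai] := ltnP i a; first by apply: s1; lia.
have [lt_iab|le_abi] := ltnP i (a + b); first by apply: s2; lia.
by apply: s3; lia.
Qed.

Lemma chromsym_spider a b l :
  chromsym (@spider_adj a b l) =
  let x := fun i : 'I_(spider_order a b l) => 'X_i : {mpoly rat[_]} in
  \sum_c x c * (leg x a c * leg x b c * leg x l c).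
Proof.
rewrite /= -wordsum_spider -sum_ffun_wordsum /chromsym big_mkcond /=.
apply: eq_bigr => k _.
have -> : \prod_(v < spider_order a b l) 'X_(k v) =
    \prod_(d <- [seq k i | i <- enum 'I_(spider_order a b l)]) 'X_d :> {mpoly rat[_]}.
  by rewrite big_map big_enum.
case kE: [seq k i | i <- enum 'I_(spider_order a b l)] => [|c t].
  by have /(congr1 size) := kE; rewrite size_map size_enum_ord.
by rewrite (proper_spiderP kE); case: ifP; rewrite ?mul1r ?mul0r.
Qed.

Lemma chromsym_spider2 a b :
  chromsym (@spider_adj a b 2) =
  spider2_expr (pathseq (mesym (spider_order a b 2) rat)) a b.
Proof.
rewrite chromsym_spider /= sum_spider2.
by apply: eq_spider2_expr => m; rewrite pathsum_mesym.
Qed.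

(** * Coefficients of e_q^j e_3^k *)

Section TwoPartSizes.
Variable q : nat.
Hypothesis q_gt3 : (3 < q)%N.

(* The weights make the factors k - 1 of the recurrence for [pathseq] equal to 1. *)
Definition two_sizes k : {poly rat} :=
  if k == 3%N then (1 / 2)%:P else if k == q then (q.-1%:R^-1)%:P * 'X else 0.

Notation pcoef m j := (pathseq two_sizes m)`_j.

Lemma two_sizes_ge0 k j : 0 <= (two_sizes k)`_j.
Proof.
rewrite /two_sizes; case: ifP => _; first by rewrite coefC; case: ifP.
case: ifP => _; last by rewrite coef0.
by rewrite coefCM coefX mulr_ge0 ?invr_ge0 ?ler0n.
Qed.

Lemma two_sizes_eq0 k : (q < k)%N -> two_sizes k = 0.
Proof. by rewrite /two_sizes => lt_qk; do 2![case: eqP => [|_]; first lia]. Qed.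

Lemma pathseq_two_sizes m :
  pathseq two_sizes m.+1 = two_sizes m.+1
    + (if (2 < m.+1)%N then pathseq two_sizes (m.+1 - 3) else 0)
    + (if (q <= m.+1)%N then 'X * pathseq two_sizes (m.+1 - q) else 0).
Proof.
rewrite pathseqS -addrA; congr (_ + _).
have two i : two_sizes i.+1 *+ i = (i == 2)%N%:R + (i == q.-1)%N%:R * 'X.
  rewrite /two_sizes; case: (i =P 2%N) => [->|ni2].
    rewrite (_ : 2%N == q.-1 = false); last by lia.
    by rewrite eqxx -polyCMn mul0r addr0; congr (_%:P).
  have -> : (i.+1 == 3%N) = false by apply/eqP => i2; apply: ni2; lia.
  have -> : (i.+1 == q) = (i == q.-1) by lia.
  case: eqP => [->|_]; last by rewrite mul0rn mul0r addr0.
  rewrite add0r mul1r -mulrnAl -polyCMn -[X in X%:P]mulr_natr mulVf ?mul1r // pnatr_eq0; lia.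
under eq_bigr => i _ do rewrite two mulrDl -mulrA.
rewrite big_split /=; congr (_ + _).
  case: ifP => [lt_2m|le_m2]; last first.
    by rewrite big1 // => i _; case: eqP => [ie|_]; rewrite ?mul0r //; have := ltn_ord i; lia.
  rewrite (bigD1 (Ordinal lt_2m)) //= mul1r big1 ?addr0 // => i ni2.
  by rewrite -[_ == 2%N]/(i == Ordinal lt_2m) (negPf ni2) mul0r.
case: ifP => [le_qm|lt_mq]; last first.
  by rewrite big1 // => i _; case: eqP => [ie|_]; rewrite ?mul0r //; have := ltn_ord i; lia.
have lt_q1m : (q.-1 < m.+1)%N by lia.
rewrite (bigD1 (Ordinal lt_q1m)) //= eqxx mul1r big1 ?addr0 => [|i niq].
  by congr (_ * pathseq _ _); lia.
by rewrite -[_ == q.-1]/(i == Ordinal lt_q1m) (negPf niq) mul0r.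
Qed.

Lemma pcoefS m j : pcoef m.+1 j = (two_sizes m.+1)`_j
    + (if (2 < m.+1)%N then pcoef (m.+1 - 3) j else 0)
    + (if (q <= m.+1)%N && (0 < j)%N then pcoef (m.+1 - q) j.-1 else 0).
Proof.
rewrite pathseq_two_sizes !coefD; congr (_ + _ + _).
  by case: ifP; rewrite ?coef0.
case: ifP => _; rewrite ?coef0 // coefXM lt0n.
by case: eqP.
Qed.

(** The monomials come from compositions of m with j parts q and all other parts 3. *)
Lemma pcoef_eq0 m j : (forall k, m <> q * j + 3 * k)%N -> pcoef m j = 0.
Proof.
have [n] := ubnP m; elim: n m j => // n IHn [|m] j lt_mn no_k.
  by rewrite coef1; case: eqP => // j0; case: (no_k 0%N); rewrite j0; lia.
rewrite pcoefS (_ : _`_j = 0) ?add0r; last first.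
  rewrite /two_sizes; case: eqP => [m3|_].
    by rewrite coefC; case: eqP => // j0; case: (no_k 1%N); rewrite j0; lia.
  case: eqP => [mq|_]; last by rewrite coef0.
  rewrite coefCM coefX; case: eqP => [j1|_]; last by rewrite mulr0.
  by case: (no_k 0%N); rewrite j1; lia.
case: ifP => [lt_2m|_]; last rewrite add0r.
  rewrite IHn ?add0r; [|lia|move=> k mk; apply: (no_k k.+1); lia].
  case: ifP => // /andP[le_qm j_gt0]; apply: IHn; first by lia.
  by move=> k mk; apply: (no_k k); case: j j_gt0 mk {no_k} => //= j _; rewrite mulnS; lia.
case: ifP => // /andP[le_qm j_gt0]; apply: IHn; first by lia.
by move=> k mk; apply: (no_k k); case: j j_gt0 mk {no_k} => //= j _; rewrite mulnS; lia.
Qed.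

(** Compositions into t + 1 parts, j of them q, split by the last part k: it has weight k e_k, that
    is q/(q - 1) or 3/2, while the other t parts have weight 1 and any order. *)
Definition gcoef t j : rat :=
  (1 + q.-1%:R^-1) * (if j is j'.+1 then 'C(t, j')%:R else 0) + 3 / 2 * 'C(t, j)%:R.

(* [t.+1] is the number of parts: [j] of size q and [t.+1 - j] of size 3. *)
Lemma pcoefE m j t : m = ((q - 3) * j + 3 * t.+1)%N -> pcoef m j = gcoef t j.
Proof.
elim: t m j => [|t IHt] [|m] j mE; [by rewrite muln1 addnS in mE| |by rewrite mulnS addnC in mE|];
  rewrite pcoefS mE /gcoef.
  (* A single part: it is 3 for j = 0 and q for j = 1; for j >= 2 both sides vanish. *)
  case: j mE => [|[|j]] mE.
  - rewrite muln0 /= (_ : (q <= 3)%N = false); last by lia.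
    rewrite bin0 coefC /= coef1 /= mulr0 add0r addr0; by field.
  - rewrite muln1 (_ : (q - 3 + 3 * 1 = q)%N); last by lia.
    rewrite leqnn /= subnn coef1 eqxx (_ : (2 < q)%N); last by lia.
    rewrite pcoef_eq0; last by move=> k; lia.
    rewrite /two_sizes eqxx (_ : (q == 3)%N = false); last by lia.
    by rewrite coefCM coefX !mulr1 mulr0 !addr0 addrC.
  rewrite two_sizes_eq0 ?coef0; last by lia.
  rewrite !pcoef_eq0 //=; try by move=> k; lia.
  by rewrite !bin0n !mulr0 !if_same !addr0.
(* With two or more parts e_m contributes nothing; removing a part 3 or q gives Pascal's rule. *)
have -> : (two_sizes ((q - 3) * j + 3 * t.+2)%N)`_j = 0.
  rewrite /two_sizes; case: eqP => [|_]; first by move: ((q - 3) * j)%N => P; lia.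
  case: eqP => [mq|_]; last by rewrite coef0.
  rewrite coefCM coefX; case: eqP => [j1|_]; last by rewrite mulr0.
  by rewrite j1 in mq; lia.
rewrite (_ : (2 < _)%N); last by move: ((q - 3) * j)%N => P; lia.
rewrite (IHt _ j); last by move: ((q - 3) * j)%N => P; lia.
case: j mE => [|j] mE; first by rewrite andbF /gcoef !bin0; ring.
rewrite (_ : (q <= _)%N); last by rewrite mulnS; move: ((q - 3) * j)%N => P; lia.
rewrite /= (IHt _ j); last by rewrite mulnS; move: ((q - 3) * j)%N => P; lia.
rewrite /gcoef binS natrD; case: j mE => [|j] mE; first by rewrite !bin0; ring.
by rewrite (binS t j) natrD; ring.
Qed.

End TwoPartSizes.

Lemma spider_pcoef_ge0 a b q j : (3 < q <= a + b)%N -> spider_e_positive a b 2 ->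
  0 <= (pathseq (two_sizes q) (a + b).+3)`_j
     - (pathseq (two_sizes q) b.+1 * pathseq (two_sizes q) a.+2)`_j
     - (pathseq (two_sizes q) b.+2 * pathseq (two_sizes q) a.+1)`_j.
Proof.
case/andP=> q_gt3 le_qn; rewrite /spider_e_positive chromsym_spider2 => ep.
have := e_positive_specialize (two_sizes_ge0 q) _ ep j.
(* No sum of parts 3 and q equals 1 or 2, so the products with P_1 and P_2 drop out. *)
have small m : (0 < m < 3)%N -> pathseq (two_sizes q) m = 0.
  by move=> lt_m3; apply/polyP => i; rewrite coef0 pcoef_eq0 // => k; case: i; lia.
rewrite /spider2_expr (small 1%N) // (small 2%N) // !mul0r !addr0 !coefB; apply.
by move=> k lt_nk; apply: two_sizes_eq0 => //; rewrite /spider_order in lt_nk; lia.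
Qed.

Lemma natr_bin (R : comNzRingType) t j :
  'C(t, j)%:R * j`!%:R = \prod_(i < j) (t%:R - i%:R) :> R.
Proof.
rewrite -natrM bin_ffact; elim: j => [|j IHj]; first by rewrite big_ord0.
rewrite big_ord_recr -IHj ffactnSr natrM /=.
have [le_jt|lt_tj] := leqP j t; first by rewrite natrB.
by rewrite ffact_small // !mul0r.
Qed.

(** Makes [gcoef] polynomial. The formulas also hold for t < j, where the falling factorial
    vanishes. *)
Lemma natr_binE t (T := t%:R : rat) :
  ('C(t, 1)%:R = T) * ('C(t, 2)%:R = T * (T - 1) / 2) *
  ('C(t, 3)%:R = T * (T - 1) * (T - 2) / 6) *
  ('C(t, 4)%:R = T * (T - 1) * (T - 2) * (T - 3) / 24) *
  ('C(t, 5)%:R = T * (T - 1) * (T - 2) * (T - 3) * (T - 4) / 120) *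
  ('C(t, 6)%:R = T * (T - 1) * (T - 2) * (T - 3) * (T - 4) * (T - 5) / 720).
Proof.
have binE j (c : rat) : j`!%:R = c -> c != 0 ->
    'C(t, j)%:R = (\prod_(i < j) (T - i%:R)) / c.
  by move=> <- c0; rewrite -natr_bin mulfK.
do !split; first by rewrite bin1.
- by rewrite (binE _ 2) // !big_ord_recr big_ord0 /= mul1r subr0.
- by rewrite (binE _ 6) // !big_ord_recr big_ord0 /= mul1r subr0.
- by rewrite (binE _ 24) // !big_ord_recr big_ord0 /= mul1r subr0.
- by rewrite (binE _ 120) // !big_ord_recr big_ord0 /= mul1r subr0.
- by rewrite (binE _ 720) // !big_ord_recr big_ord0 /= mul1r subr0.
Qed.

Lemma pcoef_mod3_eq0 q m j : (3 < q)%N -> (m %% 3 != q * j %% 3)%N ->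
  (pathseq (two_sizes q) m)`_j = 0.
Proof. by move=> q_gt3 mj; apply: pcoef_eq0 => // k mE; rewrite mE in mj; lia. Qed.

Section Products.
Variables q m n : nat.
Hypothesis q_gt3 : (3 < q)%N.
Notation p := (pathseq (two_sizes q)).

Lemma coef_mul_pcoef j : (p m * p n)`_j =
  \sum_(i < j.+1 | (m %% 3 == q * i %% 3)%N) (p m)`_i * (p n)`_(j - i).
Proof.
rewrite coefM (bigID (fun i : 'I_j.+1 => m %% 3 == q * i %% 3)%N) /=.
rewrite [X in _ + X]big1 ?addr0 // => i mi.
by rewrite pcoef_mod3_eq0 ?mul0r.
Qed.

End Products.

(** [r] is the residue mod 3 of the degrees at which the first factor can be nonzero. *)
Ltac pcoef_sum q r :=
  rewrite (@coef_mul_pcoef q _ _ isT) (eq_bigl (fun i : 'I_ _ => (i %% 3 == r)%N));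
    [rewrite big_mkcond !big_ord_recr big_ord0 /= ?add0r ?addr0
    |by move=> i /=; lia].

(** Modulo 3 only the degree splitting 2 + 0 survives in the first product and 1 + 1 in the
    second. *)
Lemma coef_e5_2_ge0 A B :
  spider_e_positive (3 * A.+2 + 1) (3 * B.+2) 2 ->
  0 <= gcoef 5 (A + B).+3 2 - gcoef 5 B 2 * gcoef 5 A.+2 0
       - gcoef 5 B.+1 1 * gcoef 5 A.+1 1.
Proof.
move/(@spider_pcoef_ge0 _ _ 5 2) => /(_ (ltac:(lia))).
rewrite (@pcoefE 5 isT _ 2 (A + B).+3); last by lia.
pcoef_sum 5%N 2%N; pcoef_sum 5%N 1%N.
rewrite (@pcoefE 5 isT _ 2 B); last by lia.
rewrite (@pcoefE 5 isT _ 0 A.+2); last by lia.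
rewrite (@pcoefE 5 isT _ 1 B.+1); last by lia.
rewrite (@pcoefE 5 isT _ 1 A.+1); last by lia.
apply.
Qed.

Lemma coef_e4_2_ge0 A B :
  spider_e_positive (3 * A.+2 + 2) (3 * B.+2) 2 ->
  0 <= gcoef 4 (A + B).+4 2 - gcoef 4 B.+1 1 * gcoef 4 A.+2 1
       - gcoef 4 B.+1 2 * gcoef 4 A.+2 0.
Proof.
move/(@spider_pcoef_ge0 _ _ 4 2) => /(_ (ltac:(lia))).
rewrite (@pcoefE 4 isT _ 2 (A + B).+4); last by lia.
pcoef_sum 4%N 1%N; pcoef_sum 4%N 2%N.
rewrite (@pcoefE 4 isT _ 1 B.+1); last by lia.
rewrite (@pcoefE 4 isT _ 1 A.+2); last by lia.
rewrite (@pcoefE 4 isT _ 2 B.+1); last by lia.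
rewrite (@pcoefE 4 isT _ 0 A.+2); last by lia.
apply.
Qed.

(** The leading form in A and B is a positive multiple of (A + B)(2A - B)(A - 2B), which is negative
    for 0 < B <= A < 2B. *)
Lemma coef_e4_3_ge0 A B :
  spider_e_positive (3 * A.+2) (3 * B.+2) 2 ->
  0 <= gcoef 4 (A + B).+3 3 - gcoef 4 B.+1 1 * gcoef 4 A.+1 2
       - gcoef 4 B.+1 2 * gcoef 4 A.+1 1.
Proof.
move/(@spider_pcoef_ge0 _ _ 4 3) => /(_ (ltac:(lia))).
rewrite (@pcoefE 4 isT _ 3 (A + B).+3); last by lia.
pcoef_sum 4%N 1%N; pcoef_sum 4%N 2%N.
rewrite (@pcoefE 4 isT _ 1 B.+1); last by lia.
rewrite (@pcoefE 4 isT _ 2 A.+1); last by lia.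
rewrite (@pcoefE 4 isT _ 2 B.+1); last by lia.
rewrite (@pcoefE 4 isT _ 1 A.+1); last by lia.
apply.
Qed.

(** Each product keeps two degree splittings, 1 + 5 and 4 + 2, or 2 + 4 and 5 + 1. The leading form
    is still negative at A = 2B, where that of e_4^3 vanishes. *)
Lemma coef_e4_6_ge0 A B :
  spider_e_positive (3 * A.+2) (3 * B.+2) 2 ->
  0 <= gcoef 4 (A + B).+2 6
       - (gcoef 4 B.+1 1 * gcoef 4 A 5 + gcoef 4 B 4 * gcoef 4 A.+1 2)
       - (gcoef 4 B.+1 2 * gcoef 4 A 4 + gcoef 4 B 5 * gcoef 4 A.+1 1).
Proof.
move/(@spider_pcoef_ge0 _ _ 4 6) => /(_ (ltac:(lia))).
rewrite (@pcoefE 4 isT _ 6 (A + B).+2); last by lia.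
pcoef_sum 4%N 1%N; pcoef_sum 4%N 2%N.
rewrite (@pcoefE 4 isT _ 1 B.+1); last by lia.
rewrite (@pcoefE 4 isT _ 5 A); last by lia.
rewrite (@pcoefE 4 isT _ 4 B); last by lia.
rewrite (@pcoefE 4 isT _ 2 A.+1); last by lia.
rewrite (@pcoefE 4 isT _ 2 B.+1); last by lia.
rewrite (@pcoefE 4 isT _ 4 A); last by lia.
rewrite (@pcoefE 4 isT _ 5 B); last by lia.
rewrite (@pcoefE 4 isT _ 1 A.+1); last by lia.
apply.
Qed.

(** * The inequalities *)

(** The difference of the two sides is 48 times the coefficient in [coef_e5_2_ge0]. *)
Lemma spider_bound_mod1 a b : (6 <= a)%N -> (6 <= b)%N ->
  (a %% 3 = 1)%N -> (b %% 3 = 0)%N -> spider_e_positive a b 2 ->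
  (4 * a * b + 18 * a + 2 * b ^ 2 + 121 <= 4 * a ^ 2 + 54 * b)%N.
Proof.
move=> a6 b6 a1 b0.
have [A aE] : exists A, a = (3 * A.+2 + 1)%N by exists (a %/ 3).-2; lia.
have [B bE] : exists B, b = (3 * B.+2)%N by exists (b %/ 3).-2; lia.
rewrite {a6 b6 a1 b0}aE {}bE => /coef_e5_2_ge0.
rewrite /gcoef !natr_binE !bin0 /= -(ler_nat rat).
rewrite !(natrD, natrM, natrX) -[A.+2]addn2 -[B.+2]addn2
  -[(A + B).+3]addn3 -[A.+1]addn1 -[B.+1]addn1 !natrD.
move: (A%:R : rat) (B%:R : rat) => x y; lra.
Qed.

(** The difference of the two sides is 72 times the coefficient in [coef_e4_2_ge0]. *)
Lemma spider_bound_mod2 a b : (6 <= a)%N -> (6 <= b)%N ->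
  (a %% 3 = 2)%N -> (b %% 3 = 0)%N -> spider_e_positive a b 2 ->
  (6 * a * b + 4 * a + 3 * b ^ 2 + 18 <= 6 * a ^ 2 + 11 * b)%N.
Proof.
move=> a6 b6 a2 b0.
have [A aE] : exists A, a = (3 * A.+2 + 2)%N by exists (a %/ 3).-2; lia.
have [B bE] : exists B, b = (3 * B.+2)%N by exists (b %/ 3).-2; lia.
rewrite {a6 b6 a2 b0}aE {}bE => /coef_e4_2_ge0.
rewrite /gcoef !natr_binE !bin0 /= -(ler_nat rat).
rewrite !(natrD, natrM, natrX) -[A.+2]addn2 -[B.+2]addn2
  -[(A + B).+4]addn4 -[B.+1]addn1 !natrD.
move: (A%:R : rat) (B%:R : rat) => x y; lra.
Qed.

(** Gives [lra] the sign of each monomial, which it treats as an atom. *)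
Lemma monomials_ge0 (u v : nat) i j : 0 <= u%:R ^+ i * v%:R ^+ j :> rat.
Proof. by rewrite mulr_ge0 ?exprn_ge0. Qed.

(* With b = 3(B+2) and a = 3(A+2), these substitutions turn the range of a/b into
   u, v >= 0, where the coefficient is a polynomial in u and v with negative terms. *)
Lemma not_e_positive_low (u v c : nat) : (c <= 3)%N ->
  ~ spider_e_positive (3 * (2 * u + v + c).+2) (3 * (u + v).+2) 2.
Proof.
move=> c3 /coef_e4_3_ge0; rewrite /gcoef !natr_binE !bin0 /=.
have := (monomials_ge0 u v 1 0, monomials_ge0 u v 0 1, monomials_ge0 u v 2 0,
  monomials_ge0 u v 1 1, monomials_ge0 u v 0 2, monomials_ge0 u v 3 0,
  monomials_ge0 u v 2 1, monomials_ge0 u v 1 2, monomials_ge0 u v 0 3).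
move=> [[[[[[[[]]]]]]]].
case: c c3 => [|[|[|[|c]]]] // _; lra.
Qed.

(** Covers 2b + 6 <= a <= 3b: here a - 2b = 3(u + c + 2) and 3b - a = 3(v + 2 - c). *)
Lemma not_e_positive_high (u v c : nat) : (c <= 2)%N ->
  ~ spider_e_positive (3 * (3 * u + 2 * v + (8 + c)).+2) (3 * (u + v + 2).+2) 2.
Proof.
move=> c2 /coef_e4_6_ge0; rewrite /gcoef !natr_binE !bin0 /=.
have m := monomials_ge0 u v.
(* Compensates the only term of the wrong sign, [v ^+ 3] at [c = 0]. *)
have : 0 <= (v%:R * (v%:R - 5)) ^+ 2 :> rat by exact: sqr_ge0.
have := (m 1 0, m 0 1,
  m 2 0, m 1 1, m 0 2,
  m 3 0, m 2 1, m 1 2, m 0 3,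
  m 4 0, m 3 1, m 2 2, m 1 3, m 0 4,
  m 5 0, m 4 1, m 3 2, m 2 3, m 1 4, m 0 5,
  m 6 0, m 5 1, m 4 2, m 3 3, m 2 4, m 1 5, m 0 6).
move=> [[[[[[[[[[[[[[[[[[[[[[[[[[]]]]]]]]]]]]]]]]]]]]]]]]]].
case: c c2 => [|[|[|c]]] // _; lra.
Qed.

Lemma spider_bound_mod0 a b : (12 <= b <= a)%N ->
  (a %% 3 = 0)%N -> (b %% 3 = 0)%N -> spider_e_positive a b 2 ->
  (3 * b + 3 <= a)%N.
Proof.
move=> ab a0 b0 ep; rewrite leqNgt; apply/negP => lt_a.
have [A aE] : exists A, a = (3 * A.+2)%N by exists (a %/ 3).-2; lia.
have [B bE] : exists B, b = (3 * B.+2)%N by exists (b %/ 3).-2; lia.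
have [le_A|lt_A] := leqP A (2 * B + 3).
- have [u [v [c [c3 [AE BE]]]]] :
      exists u v c, (c <= 3)%N /\ A = (2 * u + v + c)%N /\ B = (u + v)%N.
    (* Usually c = 3; for A < B + 3 truncated subtraction gives u = 0 and c = A - B. *)
    by exists (A - B - 3)%N, (B - (A - B - 3))%N, (minn 3 (A - B)); lia.
  by apply: (@not_e_positive_low u v c) => //; rewrite -AE -BE -aE -bE.
- have [u [v [c [c2 [AE BE]]]]] :
      exists u v c, (c <= 2)%N /\ A = (3 * u + 2 * v + (8 + c))%N /\ B = (u + v + 2)%N.
    (* Likewise u = 0 and c < 2 for A < 2B + 6. The bounds b >= 12 and a <= 3b make v an exact
       difference. *)
    exists (A - 2 * B - 6)%N, (B - 2 - (A - 2 * B - 6))%N, (minn 2 (A - 2 * B - 4)).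
    by lia.
  by apply: (@not_e_positive_high u v c) => //; rewrite -AE -BE -aE -bE.
Qed.

(* The bounds over the real numbers *)
From Stdlib Require Import Reals Lra.
Local Close Scope ring_scope.

Lemma sqrt_le_of_sqr x y : (0 <= y)%R -> (x <= y * y)%R -> (sqrt x <= y)%R.
Proof. by move=> y0 xy; rewrite -[y]sqrt_square //; apply: sqrt_le_1_alt. Qed.

Theorem theorem4p5 (a b : nat) :
  (b <= a)%nat -> (12 <= b)%nat -> (3 %| b)%nat ->
  spider_e_positive a b 2 ->
  (if (a %% 3 == 0)%nat then (INR a >= 3 * INR b + 3)%R
   else if (a %% 3 == 1)%nat then
     (INR a >= INR b / 2 + 9 / 4
              + sqrt (12 * INR b ^ 2 - 180 * INR b + 565) / 4)%R
   else
     (INR a >= INR b / 2 + 1 / 3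
              + sqrt (27 * INR b ^ 2 - 54 * INR b + 112) / 6)%R).
Proof.
move=> le_ba b12 b3 ep.
have b0 : (b %% 3 = 0)%nat by apply/eqP.
have ba : (12 <= b <= a)%nat by rewrite b12.
have a6 : (6 <= a)%nat by lia.
have b6 : (6 <= b)%nat by lia.
have bR : (12 <= IZR (Z.of_nat b))%R by apply: IZR_le; lia.
have abR : (IZR (Z.of_nat b) <= IZR (Z.of_nat a))%R by apply: IZR_le; lia.
rewrite !INR_IZR_INZ; case: eqP => [a0|na0].
  have le_Z : (3 * Z.of_nat b + 3 <= Z.of_nat a)%Z.
    by have := spider_bound_mod0 ba a0 b0 ep; lia.
  by move/IZR_le: le_Z; rewrite plus_IZR mult_IZR; Lra.lra.
case: eqP => [a1|na1].
  have le_Z : (4 * Z.of_nat a * Z.of_nat b + 18 * Z.of_nat a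
      + 2 * (Z.of_nat b * Z.of_nat b) + 121
      <= 4 * (Z.of_nat a * Z.of_nat a) + 54 * Z.of_nat b)%Z.
    by have := spider_bound_mod1 a6 b6 a1 b0 ep; rewrite -!mulnn; lia.
  move/IZR_le: le_Z; rewrite !(plus_IZR, mult_IZR).
  move: (IZR (Z.of_nat a)) (IZR (Z.of_nat b)) bR abR => x y bR abR le_xy.
  (* Completing the square: 4 times [le_xy] compares the radicand with the square of the right side,
     which is positive as x >= y >= 12. *)
  have : (sqrt (12 * y ^ 2 - 180 * y + 565) <= 4 * x - 2 * y - 9)%R.
    by apply: sqrt_le_of_sqr; Lra.lra.
  by Lra.lra.
have a2 : (a %% 3 = 2)%nat by lia.
have le_Z : (6 * Z.of_nat a * Z.of_nat b + 4 * Z.of_nat a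
    + 3 * (Z.of_nat b * Z.of_nat b) + 18
    <= 6 * (Z.of_nat a * Z.of_nat a) + 11 * Z.of_nat b)%Z.
  by have := spider_bound_mod2 a6 b6 a2 b0 ep; rewrite -!mulnn; lia.
move/IZR_le: le_Z; rewrite !(plus_IZR, mult_IZR).
move: (IZR (Z.of_nat a)) (IZR (Z.of_nat b)) bR abR => x y bR abR le_xy.
(* The same with 6 times [le_xy]. *)
have : (sqrt (27 * y ^ 2 - 54 * y + 112) <= 6 * x - 3 * y - 2)%R.
  by apply: sqrt_le_of_sqr; Lra.lra.
by Lra.lra.
Qed.
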